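(* Let $p$ be a prime and $n$ a sufficiently large positive integer with $n^{6}\le p\le n^{C}$ for a fixed constant $C$. For every $n$-element set $X\subset[p]$, $\sum_{x\in X}\mathfrak{e}(x)\le \widetilde{\mathcal{O}}(p)$, i.e. at most $p\cdot(\log n)^{\mathcal{O}(1)}$.
   Context: $[N]=\{0,\dots,N-1\}$; $\mathfrak{m}_p(x)$ is the unique element of $(x+p\mathbb{Z})\cap[0,p)$. For $x\in[p]$, the overlap of $x$ is the number of $a\in\{1,2,\dots,\lceil p/2\rceil-1\}$ with $\mathfrak{m}_p(ax)<p/2$, and the excess overlap $\mathfrak{e}(x)$ is the overlap of $x$ minus $p/4$. *)

(* Defs.v *)
From HB Require Import structures.
From mathcomp Require Import all_boot all_order all_algebra.
From mathcomp Require Import all_classical all_reals all_analysis.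
Set Implicit Arguments.
Unset Strict Implicit.
Unset Printing Implicit Defensive.
Import Order.TTheory GRing.Theory Num.Theory.
Local Open Scope ring_scope.

(* The representative of [x + pZ] in [0, p): for [p > 0], [(_ %% _)%Z] is the
   nonnegative Euclidean remainder. *)
Definition mres (p : nat) (x : int) : int := (x %% p%:Z)%Z.

(* [uphalf p] is the ceiling of [p / 2], so that the ordinals [a] below with
   [0 < a] are exactly 1, ..., ceil(p/2) - 1. *)
Definition overlap (p : nat) (x : 'I_p) : nat :=
  #|[set a : 'I_(uphalf p) |
      (0 < a)%N && ((mres p (a%:Z * x%:Z))%:~R < p%:R / 2%:R :> rat)]|.

Definition excess_overlap (R : realType) (p : nat) (x : 'I_p) : R :=
  (overlap x)%:R - p%:R / 4%:R.

(* Main.v *)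
Require Import Defs.
From HB Require Import structures.
From mathcomp Require Import all_boot all_order all_algebra.
From mathcomp Require Import all_classical all_reals all_analysis.
From mathcomp Require Import zify ring lra.
Set Implicit Arguments.
Unset Strict Implicit.
Unset Printing Implicit Defensive.
Import Order.TTheory GRing.Theory Num.Theory numFieldNormedType.Exports.
Local Open Scope ring_scope.

(* For odd prime [p], let [s] be the odd square wave on Z/pZ, equal to 1 on
   (0, p/2) and -1 on (p/2, p), and [T x] the sum of [s (a x)] over 0 < a < p/2.
   Up to O(1), [T x] is twice the excess overlap of [x <> 0]. With [D k] the sum
   of sin(2 pi k a / p) over 0 < a < p/2, Fourier inversion of [s] gives
   p T(x) = 2 \sum_k D(k) D(kx). Since x |-> kx permutes Z/pZ for k <> 0, the
   sum of |T x| over ALL x is at most (2 / p) (\sum_k |D k|)^2, and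
   |D k| <= 1 / sin(pi k / p) makes \sum_k |D k| = O(p log p). So the total
   excess over any set, of any size, is O(p log^2 p), and log p = O(log n). *)

(** * Cosecant sums and harmonic numbers *)

Lemma sin_pi_ge (R : realType) (t : R) : 0 <= t <= 2^-1 -> t <= sin (pi * t).
Proof.
move=> /andP[t0 t2]; have pi2 := @pi_ge2 R.
have [->|tn0] := eqVneq t 0; first by rewrite mulr0 sin0.
have tp : 0 < t by rewrite lt_neqAle eq_sym tn0.
set x := pi * t; have x0 : 0 < x by rewrite mulr_gt0// pi_gt0.
have xpi2 : x <= pi / 2 by rewrite /x; nra.
have sge0 : 0 <= sin x by apply: sin_ge0_pi; apply/andP; split; lra.
(* If [cos x < 1/2], then [sin x >= 1/2 >= t]. Otherwise the mean value theorem gives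
   [sin x = cos c * x] with [cos c > 1/2] and [x = pi * t >= 2 * t]. *)
have [c12|c12] := leP (2^-1) (cos x); last first.
  have cge0 : 0 <= cos x by apply: cos_ge0_pihalf; apply/andP; split; lra.
  have := cos2Dsin2 x; nra.
have cs : {within `[0, x], continuous (@sin R)}%classic.
  exact/continuous_subspaceT/continuous_sin.
have [c] := MVT x0 (fun y _ => is_derive_sin y) cs.
rewrite in_itv/= sin0 !subr0 => /andP[c0 cx] ->.
have : cos x < cos c by rewrite ltr_cos// in_itv/=; apply/andP; split; lra.
have : 2 * t <= x by rewrite /x; nra.
move: (x) x0 c12 => y; nra.
Qed.

(** With [t = k/p] and [u = 1 - t], the right side is [1/(t * u)], and [sin (pi * t)] is at least
    the smaller of [t] and [u], hence at least [t * u]. This shape sums to two harmonic sums. *)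
Lemma invr_sin_pi_le (R : realType) (p k : nat) : (0 < k < p)%N ->
  (sin (pi * k%:R / p%:R))^-1 <= p%:R * (k%:R^-1 + (p - k)%:R^-1) :> R.
Proof.
move=> /andP[k0 kp].
have p0 : (0 : R) < p%:R by rewrite ltr0n; lia.
have k0' : (0 : R) < k%:R by rewrite ltr0n.
have q0' : (0 : R) < (p - k)%:R by rewrite ltr0n; lia.
have pE : p%:R = k%:R + (p - k)%:R :> R by rewrite -natrD subnKC// ltnW.
set t : R := k%:R / p%:R; set u : R := (p - k)%:R / p%:R.
have tu : t + u = 1 by rewrite /t /u -mulrDl -pE divff// gt_eqF.
have t0 : 0 < t by rewrite divr_gt0.
have u0 : 0 < u by rewrite divr_gt0.
have main : t * u <= sin (pi * t).
  have [t2|t2] := leP t 2^-1.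
    have : t <= sin (pi * t) by apply: sin_pi_ge; rewrite ltW.
    nra.
  have -> : sin (pi * t) = sin (pi * u).
    have -> : pi * t = - (pi * u) + pi by rewrite -[X in _ + X]mulr1 -tu; ring.
    by rewrite sinDpi sinN opprK.
  have : u <= sin (pi * u) by apply: sin_pi_ge; apply/andP; split; lra.
  nra.
rewrite -mulrA -/t.
have -> : p%:R * (k%:R^-1 + (p - k)%:R^-1) = (t * u)^-1.
  rewrite /t /u; move: p0; rewrite !pE => kq0.
  move: (k%:R) ((p - k)%:R) k0' q0' kq0 => a b a0 b0 ab0.
  by field; rewrite !gt_eqF.
have tu0 : 0 < t * u by rewrite mulr_gt0.
by rewrite lef_pV2 ?posrE// (lt_le_trans tu0 main).
Qed.

Lemma harmonic_le_ln (R : realType) (m : nat) :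
  \sum_(1 <= k < m.+2) k%:R^-1 <= 1 + ln m.+1%:R :> R.
Proof.
elim: m => [|m IH]; first by rewrite big_nat1 ln1 invr1 addr0.
rewrite big_nat_recr//=.
have : ln (m.+2%:R : R) - ln m.+1%:R >= m.+2%:R^-1.
  have := @le_ln1Dx R (- m.+2%:R^-1).
  have -> : 1 + - m.+2%:R^-1 = m.+1%:R / m.+2%:R :> R.
    have m2 : m.+2%:R != 0 :> R by rewrite pnatr_eq0.
    by apply: (mulIf m2); rewrite mulrDl mulNr mul1r mulVf// divfK//
      -natr1 addrK.
  rewrite ltrN2 invf_lt1 ?ltr0n// ltr1n => /(_ isT).
  rewrite lnM ?lnV ?posrE ?invr_gt0 ?ltr0n//.
  by rewrite -lerN2 opprB.
by move: (m.+2%:R^-1 : R) (ln _) (ln _) IH => a b c IH; lra.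
Qed.

Lemma sum_invr_sin_le (R : realType) (p : nat) : (1 < p)%N ->
  \sum_(1 <= k < p) (sin (pi * k%:R / p%:R))^-1
    <= 2 * p%:R * (1 + ln p%:R) :> R.
Proof.
move=> p1.
apply: (@le_trans _ _ (\sum_(1 <= k < p) (p%:R * (k%:R^-1 + (p - k)%:R^-1)))).
  by rewrite !big_nat; apply: ler_sum => k kp; exact: invr_sin_pi_le.
rewrite -mulr_sumr big_split/= [X in _ + X]big_nat_rev/=.
rewrite [X in _ + X](eq_big_nat _ _ (F2 := fun k => k%:R^-1)); last first.
  by move=> k /andP[k1 kp]; congr (_%:R^-1); lia.
case: p p1 => [|[|m]]// _; have := harmonic_le_ln R m.
have : ln (m.+1%:R : R) <= ln m.+2%:R by rewrite ler_ln ?posrE ?ltr0n// ler_nat.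
set p := m.+2.
have : (0 : R) < p%:R by rewrite ltr0n; lia.
nra.
Qed.

(** * Trigonometric sums and orthogonality modulo [p] *)

Lemma sum_cos_closed (R : realType) (t : R) (m : nat) :
  2 * sin t * \sum_(k < m) cos (2 * t * k%:R) =
  sin ((2 * m%:R - 1) * t) + sin t.
Proof.
elim: m => [|m IH].
  by rewrite big_ord0 !mulr0 sub0r mulN1r sinN addNr.
rewrite big_ord_recr/= mulrDr IH -(natr1 m).
have -> : (2 * m%:R - 1) * t = 2 * t * m%:R - t by ring.
have -> : (2 * (m%:R + 1) - 1) * t = 2 * t * m%:R + t by ring.
by rewrite sinB sinD; ring.
Qed.

Lemma sum_sin_closed (R : realType) (t : R) (m : nat) :
  2 * sin t * \sum_(k < m) sin (2 * t * k%:R) =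
  cos t - cos ((2 * m%:R - 1) * t).
Proof.
elim: m => [|m IH].
  by rewrite big_ord0 !mulr0 sub0r mulN1r cosN subrr.
rewrite big_ord_recr/= mulrDr IH -(natr1 m).
have -> : (2 * m%:R - 1) * t = 2 * t * m%:R - t by ring.
have -> : (2 * (m%:R + 1) - 1) * t = 2 * t * m%:R + t by ring.
by rewrite cosB cosD; ring.
Qed.

(** [sinp] and [cosp] are the imaginary and real parts of the additive character exp(2 pi i m /
    p). *)
Definition sinp (R : realType) (p m : nat) : R := sin (2 * (pi * m%:R / p%:R)).

Definition cosp (R : realType) (p m : nat) : R := cos (2 * (pi * m%:R / p%:R)).

Lemma natr_mod_split (R : realType) (p m : nat) : (0 < p)%N ->
  2 * (pi * m%:R / p%:R) =
  2 * (pi * (m %% p)%:R / p%:R) + (pi *+ 2) *+ (m %/ p)%N :> R.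
Proof.
move=> p0; have p0' : p%:R != 0 :> R by rewrite pnatr_eq0 -lt0n.
rewrite {1}(divn_eq m p) natrD natrM.
rewrite -[X in _ = _ + X]mulr_natr -[pi *+ 2]mulr_natl.
move: (m %/ p)%:R (m %% p)%:R => a b; by field.
Qed.

Lemma sinp_mod (R : realType) (p m : nat) : (0 < p)%N ->
  sinp R p (m %% p) = sinp R p m.
Proof.
by move=> p0; rewrite /sinp (natr_mod_split _ m p0) (periodicn (@sinD2pi R)).
Qed.

Lemma cosp_mod (R : realType) (p m : nat) : (0 < p)%N ->
  cosp R p (m %% p) = cosp R p m.
Proof.
by move=> p0; rewrite /cosp (natr_mod_split _ m p0) (periodicn (@cosD2pi R)).
Qed.

Lemma sin_pi_frac_gt0 (R : realType) (p d : nat) : (0 < d < p)%N ->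
  0 < sin (pi * d%:R / p%:R) :> R.
Proof.
move=> /andP[d0 dp]; apply: sin_gt0_pi.
have p0 : 0 < p%:R :> R by rewrite ltr0n; lia.
apply/andP; split; first by rewrite divr_gt0// mulr_gt0 ?pi_gt0 ?ltr0n.
by rewrite ltr_pdivrMr// ltr_pM2l ?pi_gt0// ltr_nat.
Qed.

Lemma sum_cosp (R : realType) (p d : nat) : (0 < p)%N ->
  \sum_(k < p) cosp R p (k * d) = p%:R * (p %| d)%:R.
Proof.
move=> p0; have p0' : p%:R != 0 :> R by rewrite pnatr_eq0 -lt0n.
under eq_bigr => k _ do rewrite -cosp_mod// -modnMmr cosp_mod//.
rewrite /dvdn; have [->|dn0] := eqVneq (d %% p)%N 0%N.
  under eq_bigr => k _ do rewrite /cosp muln0 !(mulr0, mul0r) cos0.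
  by rewrite sumr_const card_ord mulr1.
rewrite mulr0; set e := (d %% p)%N in dn0 *.
have e0p : (0 < e < p)%N by rewrite lt0n dn0 ltn_mod.
have s0 := sin_pi_frac_gt0 R e0p; set t : R := pi * e%:R / p%:R in s0.
have tE k : cosp R p (k * e) = cos (2 * t * k%:R).
  by rewrite /cosp natrM /t; congr cos; field.
under eq_bigr => k _ do rewrite tE.
have := sum_cos_closed t p.
(* Since [p * t = pi * e], the last angle is [- t] up to full turns, so the closed form vanishes
   while [sin t > 0]. *)
have -> : (2 * p%:R - 1) * t = - t + (pi *+ 2) *+ e.
  by rewrite -[X in _ = _ + X]mulr_natr -[pi *+ 2]mulr_natl /t; field.
rewrite (periodicn (@sinD2pi R)) sinN addNr.
by move/eqP; rewrite !mulf_eq0 pnatr_eq0 (gt_eqF s0)/= => /eqP.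
Qed.

Lemma sum_sinp_sinp (R : realType) (p a b : nat) : (a < p)%N -> (b < p)%N ->
  2 * \sum_(k < p) sinp R p (k * a) * sinp R p (k * b) =
  p%:R * ((a == b)%:R - (p %| a + b)%:R).
Proof.
move=> ap bp; have p0 : (0 < p)%N by lia.
have p0' : p%:R != 0 :> R by rewrite pnatr_eq0 -lt0n.
(* The difference [a - b] is encoded as [a + (p - b)], which lies strictly between 0 and [2p]. The
   claim then follows from 2 sin A sin B = cos(A - B) - cos(A + B) and [sum_cosp]. *)
have -> : (a == b) = (p %| a + (p - b))%N.
  have [ab|ab] := eqVneq a b; first by rewrite ab subnKC ?dvdnn// ltnW.
  symmetry; apply/negbTE/negP => /dvdnP[[|[|q]]]; nia.
rewrite mulrBr -!sum_cosp// -sumrB mulr_sumr; apply: eq_bigr => k _.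
rewrite /sinp /cosp.
have -> : 2 * (pi * (k * (a + (p - b)))%:R / p%:R) =
  2 * (pi * (k * a)%:R / p%:R) - 2 * (pi * (k * b)%:R / p%:R)
    + (pi *+ 2) *+ k :> R.
  rewrite !natrM natrD natrB ?(ltnW bp)//.
  rewrite -[X in _ = _ + X]mulr_natr -[pi *+ 2]mulr_natl.
  by field.
have -> : 2 * (pi * (k * (a + b))%:R / p%:R) =
  2 * (pi * (k * a)%:R / p%:R) + 2 * (pi * (k * b)%:R / p%:R) :> R.
  by rewrite !natrM natrD; field.
by rewrite (periodicn (@cosD2pi R)) cosB cosD; ring.
Qed.

(** * Fourier inversion of the square wave *)

Definition half_sine_sum (R : realType) (p k : nat) : R :=
  \sum_(a < uphalf p) sinp R p (k * a).

(** Written as the indicator of the lower half at [b] minus that at [-b], the form that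
    [sum_sinp_sinp] produces; the term [a = 0] cancels at [b = 0]. *)
Definition square_wave (R : realType) (p b : nat) : R :=
  \sum_(a < uphalf p) (((a : nat) == b)%:R - (p %| a + b)%:R).

Lemma half_sine_sum_mod (R : realType) (p k : nat) : (0 < p)%N ->
  half_sine_sum R p (k %% p) = half_sine_sum R p k.
Proof.
by move=> p0; apply: eq_bigr => a _; rewrite -sinp_mod// modnMml sinp_mod.
Qed.

Lemma half_sine_sum0 (R : realType) (p : nat) : half_sine_sum R p 0 = 0.
Proof. by apply: big1 => a _; rewrite /sinp mul0n mulr0 mul0r mulr0 sin0. Qed.

Lemma norm_half_sine_sum_le (R : realType) (p k : nat) : (0 < k < p)%N ->
  `|half_sine_sum R p k| <= (sin (pi * k%:R / p%:R))^-1.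
Proof.
move=> kp; have s0 := sin_pi_frac_gt0 R kp.
set t : R := pi * k%:R / p%:R in s0 *.
have p0' : p%:R != 0 :> R by rewrite pnatr_eq0; lia.
have -> : half_sine_sum R p k = \sum_(a < uphalf p) sin (2 * t * a%:R).
  by apply: eq_bigr => a _; rewrite /sinp natrM /t; congr sin; field.
rewrite -[leRHS]mul1r ler_pdivlMr// -{1}(gtr0_norm s0) -normrM mulrC.
(* The closed form makes [2 * sin t * S] a difference of two cosines, at most 2 in absolute
   value. *)
have := sum_sin_closed t (uphalf p).
set S := \sum_(_ < _) _; set c := cos (_ * t) => E.
have -> : sin t * S = (cos t - c) / 2 by rewrite -E; field.
have := cos_max t; have : `|c| <= 1 by exact: cos_max.
by rewrite !ler_norml => /andP[? ?] /andP[? ?]; apply/andP; split; lra.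
Qed.

Lemma square_wave_inversion (R : realType) (p b : nat) : (b < p)%N ->
  p%:R * square_wave R p b =
  2 * \sum_(k < p) half_sine_sum R p k * sinp R p (k * b).
Proof.
move=> bp; under [in RHS]eq_bigr => k _ do rewrite mulr_suml.
rewrite exchange_big/= !mulr_sumr; apply: eq_bigr => a _.
by rewrite sum_sinp_sinp//; have := ltn_ord a; lia.
Qed.

Lemma square_wave0 (R : realType) (p : nat) : square_wave R p 0 = 0.
Proof.
rewrite /square_wave big1// => a _; rewrite addn0.
case: (eqVneq (a : nat) 0%N) => [->|a0]; first by rewrite dvdn0 subrr.
by rewrite gtnNdvd ?subrr ?lt0n//; have := ltn_ord a; lia.
Qed.

Lemma square_waveE (R : realType) (p b : nat) : odd p -> (0 < b < p)%N ->
  square_wave R p b = if (b < uphalf p)%N then 1 else -1.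
Proof.
move=> op /andP[b0 bp]; have p2 := odd_double_half p; rewrite op in p2.
have upE : (uphalf p = p./2.+1)%N by rewrite uphalf_half op.
rewrite /square_wave sumrB.
(* As [0 < a + b < 2p], divisibility forces [a + b = p]. For odd [p], exactly one of [b] and [p - b]
   is below [uphalf p]. *)
have dE (a : 'I_(uphalf p)) : (p %| a + b)%N = ((a : nat) == p - b)%N.
  have aH := ltn_ord a; apply/idP/eqP => [/dvdnP[[|[|q]]]|->]; [nia..|].
  by rewrite subnK// ltnW.
under [X in _ - X]eq_bigr => a _ do rewrite dE.
have sumE c : \sum_(a < uphalf p) ((a : nat) == c)%:R = (c < uphalf p)%:R :> R.
  have [cH|cH] := ltnP c (uphalf p).
    rewrite (bigD1 (Ordinal cH))//= eqxx big1 ?addr0// => a.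
    by rewrite -val_eqE/= => /negbTE ->.
  by rewrite big1// => a _; rewrite ltn_eqF// (leq_trans (ltn_ord a)).
rewrite !sumE; case: ltnP => bH.
  by rewrite ltnNge (_ : (uphalf p <= p - b)%N) ?subr0//; lia.
by rewrite (_ : (p - b < uphalf p)%N) ?sub0r//; lia.
Qed.

(** * Correlations of the wave with its dilates, summed over all dilations *)

Definition wave_corr (R : realType) (p x : nat) : R :=
  \sum_(a < uphalf p) square_wave R p (a * x %% p).

Lemma wave_corrE (R : realType) (p x : nat) : (0 < p)%N ->
  p%:R * wave_corr R p x =
  2 * \sum_(k < p) half_sine_sum R p k * half_sine_sum R p (k * x).
Proof.
move=> p0; rewrite /wave_corr mulr_sumr.
under eq_bigr => a _ do rewrite square_wave_inversion ?ltn_mod//.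
rewrite -mulr_sumr exchange_big/=; congr (_ * _); apply: eq_bigr => k _.
rewrite -mulr_sumr; congr (_ * _); apply: eq_bigr => a _.
by rewrite -sinp_mod// modnMmr sinp_mod// (mulnC a) mulnA.
Qed.

Lemma sum_norm_half_sine_sum_le (R : realType) (p : nat) : (1 < p)%N ->
  \sum_(k < p) `|half_sine_sum R p k| <= 2 * p%:R * (1 + ln p%:R).
Proof.
move=> p1; apply: le_trans (sum_invr_sin_le R p1).
rewrite -(big_mkord xpredT (fun k => `|half_sine_sum R p k|)) big_ltn; last lia.
rewrite half_sine_sum0 normr0 add0r !big_nat.
by apply: ler_sum => k kp; exact: norm_half_sine_sum_le.
Qed.

Lemma sum_norm_wave_corr_le (R : realType) (p : nat) : prime p ->
  \sum_(x < p) `|wave_corr R p x| <= 8 * p%:R * (1 + ln p%:R) ^+ 2.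
Proof.
move=> pp; have p1 := prime_gt1 pp; have p0 := prime_gt0 pp.
have p0' : 0 < p%:R :> R by rewrite ltr0n.
pose S : R := \sum_(k < p) `|half_sine_sum R p k|.
have S0 : 0 <= S by apply: sumr_ge0.
(* The weight lets this hold for every [k]: it vanishes at [k = 0], where multiplication by [k] is
   not a permutation. *)
have permS (k : 'I_p) : `|half_sine_sum R p k| *
    \sum_(x < p) `|half_sine_sum R p (k * x)| = `|half_sine_sum R p k| * S.
  have [k0|k0] := posnP k; first by rewrite k0 half_sine_sum0 normr0 !mul0r.
  congr (_ * _); pose f (x : 'I_p) := Ordinal (ltn_pmod (k * x) p0).
  have f_inj : injective f.
    move=> x y /(congr1 val)/= /eqP.
    (* With [x <= y], the congruence says that [p] divides [k * (y - x)], hence [y - x < p], which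
       must be 0. *)
    wlog xy : x y / (x <= y)%N.
      move=> H; have [/H//|/ltnW/H yx] := leqP x y.
      by rewrite eq_sym => /yx.
    rewrite eq_sym eqn_mod_dvd ?leq_mul2l ?xy ?orbT// -mulnBr Euclid_dvdM//.
    rewrite gtnNdvd//= => /dvdnP[[|q]] Eq; apply/val_inj => /=.
      lia.
    by have := ltn_ord y; nia.
  rewrite /S [RHS](reindex_inj f_inj)/=.
  by apply: eq_bigr => x _; rewrite half_sine_sum_mod.
have main : p%:R * \sum_(x < p) `|wave_corr R p x| <= 2 * S ^+ 2.
  rewrite mulr_sumr.
  apply: (@le_trans _ _ (\sum_(x < p) (2 * \sum_(k < p)
      `|half_sine_sum R p k| * `|half_sine_sum R p (k * x)|))).
    apply: ler_sum => x _.
    rewrite -[X in X * _](gtr0_norm p0') -normrM wave_corrE// normrM.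
    rewrite ger0_norm// ler_pM2l// (le_trans (ler_norm_sum _ _ _))//.
    by apply: ler_sum => k _; rewrite normrM.
  rewrite -mulr_sumr exchange_big/= ler_pM2l//.
  under eq_bigr => k _ do rewrite -mulr_sumr permS.
  by rewrite -mulr_suml expr2.
have Sle := sum_norm_half_sine_sum_le R p1; rewrite -/S in Sle.
rewrite -(ler_pM2l p0') (le_trans main)//.
have : S ^+ 2 <= (2 * p%:R * (1 + ln p%:R)) ^+ 2.
  by rewrite ler_sqr ?nnegrE// (le_trans S0).
by rewrite !exprMn; lra.
Qed.

(** * From overlaps to wave correlations *)

Lemma mres_lt_half (p a x : nat) : odd p ->
  ((mres p (a%:Z * x%:Z))%:~R < p%:R / 2%:R :> rat) =
  (a * x %% p < uphalf p)%N.
Proof.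
move=> op; rewrite /mres -PoszM modz_nat -pmulrn ltr_pdivlMr ?ltr0n//.
rewrite -natrM ltr_nat uphalf_half op.
by have := odd_double_half p; rewrite op; lia.
Qed.

(** For [a > 0], [a * x] is nonzero modulo [p], so the wave there is twice the indicator of the
    lower half minus 1; there are [p./2] such [a], and [a = 0] contributes 0. *)
Lemma wave_corr_overlap (R : realType) (p : nat) (x : 'I_p) :
  prime p -> odd p -> (0 < x)%N ->
  wave_corr R p x = 2 * (overlap x)%:R - p./2%:R.
Proof.
move=> pp op x0; have p0 := prime_gt0 pp.
have up : (uphalf p <= p)%N by lia.
have -> : (overlap x)%:R =
    \sum_(a < uphalf p) ((0 < a) && (a * x %% p < uphalf p))%N%:R :> R.
  rewrite /overlap -sum1_card natr_sum big_mkcond/=; apply: eq_bigr => a _.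
  by rewrite inE mres_lt_half//; case: ifP.
have -> : p./2%:R = \sum_(a < uphalf p) (0 < a)%N%:R :> R.
  rewrite (uphalf_half p) op big_ord_recl/= add0r.
  by rewrite sumr_const card_ord.
rewrite mulr_sumr -sumrB; apply: eq_bigr => a _.
have [->|a0] := posnP a.
  by rewrite mul0n mod0n square_wave0 andFb mulr0 subrr.
rewrite square_waveE ?ltn_mod ?p0 ?andbT//; last first.
  rewrite lt0n; apply/negP; rewrite -/(dvdn _ _) Euclid_dvdM// !gtnNdvd//.
  by have := ltn_ord a; have := prime_gt1 pp; lia.
by rewrite andTb; case: ifP => _ /=; ring.
Qed.

(** For [x <> 0] the excess equals [wave_corr R p x / 2 - 1/4]. At [x = 0] the wave gives no
    information, and the trivial bound [p] is paid once. *)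
Lemma excess_overlap_le (R : realType) (p : nat) (x : 'I_p) :
  prime p -> odd p ->
  excess_overlap R x <= `|wave_corr R p x| / 2 + p%:R * ((x : nat) == 0%N)%:R.
Proof.
move=> pp op; rewrite /excess_overlap; have p0 := prime_gt0 pp.
have [x0|x0] := posnP x; last first.
  rewrite mulr0 addr0.
  have := wave_corr_overlap R pp op x0; have := ler_norm (wave_corr R p x).
  have -> : p%:R = 1 + 2 * p./2%:R :> R.
    by rewrite -{1}(odd_double_half p) op -mul2n natrD natrM.
  lra.
have : ((overlap x)%:R : R) <= p%:R.
  rewrite ler_nat (leq_trans (max_card _))// card_ord; lia.
have : (0 : R) < p%:R by rewrite ltr0n.
have := normr_ge0 (wave_corr R p x); rewrite mulr1; lra.
Qed.

Lemma sum_excess_overlap_le (R : realType) (p : nat) (X : {set 'I_p}) :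
  prime p -> odd p ->
  \sum_(x in X) excess_overlap R x <= 5 * p%:R * (1 + ln p%:R) ^+ 2.
Proof.
move=> pp op; have p0 := prime_gt0 pp.
(* A nonnegative majorant allows extending the sum from [X] to all residues. The constant 5 is 8/2
   from the correlations plus 1 from [x = 0]. *)
pose F (x : 'I_p) : R := `|wave_corr R p x| / 2 + p%:R * ((x : nat) == 0%N)%:R.
have F0 x : 0 <= F x by rewrite addr_ge0 ?mulr_ge0 ?divr_ge0.
apply: (@le_trans _ _ (\sum_x F x)).
  rewrite big_mkcond/=; apply: ler_sum => x _.
  by case: ifP => // _; exact: excess_overlap_le.
rewrite big_split/= -mulr_suml -mulr_sumr.
rewrite [X in _ + _ * X](bigD1 (Ordinal p0))//=.
rewrite [X in _ + _ * (_ + X)]big1 ?addr0; last first.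
  by move=> i; rewrite -val_eqE/= => /negbTE ->.
have := sum_norm_wave_corr_le R pp; rewrite mulr1.
have pR : (0 : R) < p%:R by rewrite ltr0n.
have l0 : 0 <= ln (p%:R : R) by rewrite ln_ge0// ler1n.
have : p%:R <= p%:R * (1 + ln p%:R) ^+ 2 :> R.
  by apply: ler_peMr; rewrite ?(ltW pR)//; apply: exprn_ege1; rewrite lerDl.
lra.
Qed.

Theorem mainTheorem10 (R : realType) (C : R) :
  exists K n0 : nat, forall n p : nat,
    (0 < n)%N -> (n0 <= n)%N ->
    prime p ->
    (n ^ 6 <= p)%N -> p%:R <= (n%:R : R) `^ C ->
    forall X : {set 'I_p}, #|X| = n ->
      \sum_(x in X) excess_overlap R x <= p%:R * ln (n%:R : R) ^+ K.
Proof.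
(* Once [L = ln n] is at least [M], also [L >= 1], so [5 * (1 + ln p) <= 5 * (1 + |C| * L) <= M * L
   <= L ^+ 2]; squaring gives the exponent 4. The threshold ensures [n >= expR M]. *)
pose M : R := 5 * (1 + `|C|).
have M5 : 5 <= M by rewrite /M; have := normr_ge0 C; lra.
exists 4%N, (maxn 2 (Num.truncn (expR M)).+1) => n p n0 nM pp np pC X _.
have n2 : (2 <= n)%N by lia.
(* The prime 2 is excluded because [p >= n ^ 6 >= 64]. *)
have op : odd p.
  case: (even_prime pp) => // p2; suff : (2 ^ 6 <= p)%N by rewrite p2.
  by rewrite (leq_trans _ np)// leq_exp2r.
have p0 := prime_gt0 pp.
have nR : 0 < n%:R :> R by rewrite ltr0n.
have pR : 0 < p%:R :> R by rewrite ltr0n.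
set L : R := ln n%:R.
have ML : M <= L.
  rewrite -ler_expR lnK ?posrE// ltW// (lt_le_trans (truncnS_gt _))// ler_nat.
  by move: nM; rewrite geq_max => /andP[].
have lp0 : 0 <= ln (p%:R : R) by rewrite ln_ge0// ler1n.
have lpL : ln p%:R <= `|C| * L.
  apply: (@le_trans _ _ (C * L)).
    by rewrite -ln_powR ler_ln// posrE powR_gt0.
  by rewrite ler_wpM2r ?ler_norm//; lra.
apply: (le_trans (sum_excess_overlap_le R X pp op)).
rewrite -[5 * _]mulrC -mulrA ler_pM2l//.
have step : 5 * (1 + ln p%:R) <= L ^+ 2.
  have : M * L <= L ^+ 2 by rewrite expr2 ler_pM2r//; lra.
  rewrite /M; have := normr_ge0 C; nra.
have : (5 * (1 + ln p%:R)) ^+ 2 <= (L ^+ 2) ^+ 2 :> R.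
  by rewrite ler_sqr ?nnegrE ?exprn_ge0//; lra.
rewrite -exprM exprMn; have : 0 <= (1 + ln (p%:R : R)) ^+ 2 by exact: sqr_ge0.
lra.
Qed.
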